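(* Let $(\mathcal C,\otimes,I)$ be a symmetric monoidal category with finite coproducts which is co-affine, i.e. its unit object $I$ is initial in $\mathcal C$, and let $\mathsf T=(T,\eta,\mu)$ be a linear exponential monad on $(\mathcal C,\otimes,I)$. Then for every finite family of objects $(A_i)_i$ of $\mathcal C$ and each index $i$, the hypernormalisation map $\mathcal N\colon T(\sum_i A_i)\to T(\sum_i TA_i)$ satisfies $$\mathcal N\circ T\iota_i=\eta_{\sum_i TA_i}\circ\iota_i\colon TA_i\to T(\textstyle\sum_i TA_i),$$ where $\iota_i$ denotes the $i$th coproduct coprojection ($A_i\to\sum_i A_i$ on the left, $TA_i\to\sum_i TA_i$ on the right).
   Context: A symmetric opmonoidal structure on a monad $\mathsf T=(T,\eta,\mu)$ on a symmetric monoidal category $(\mathcal C,\otimes,I)$ consists of a map $\upsilon_I\colon TI\to I$ and natural maps $\upsilon_{XY}\colon T(X\otimes Y)\to TX\otimes TY$ making $T$ a symmetric opmonoidal (colax monoidal) functor and $\eta,\mu$ opmonoidal transformations. It lifts the symmetric monoidal structure of $\mathcal C$ to the category $\mathcal C^{\mathsf T}$ of Eilenberg--Moore algebras: $(X,x)\otimes(Y,y)=(X\otimes Y,(x\otimes y)\circ\upsilon_{XY})$, with unit $(I,\upsilon_I)$ and constraints those of $\mathcal C$. A linear exponential monad is a symmetric opmonoidal monad for which the lifted structure on $\mathcal C^{\mathsf T}$ is given by finite coproducts: $(I,\upsilon_I)$ is initial in $\mathcal C^{\mathsf T}$, and for all algebras $(X,x),(Y,y)$ the cospan $(X,x)\cong(X,x)\otimes(I,\upsilon_I)\xrightarrow{1\otimes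 !}(X,x)\otimes(Y,y)\xleftarrow{!\otimes 1}(I,\upsilon_I)\otimes(Y,y)\cong(Y,y)$ is a coproduct in $\mathcal C^{\mathsf T}$, where $!$ denotes the unique maps out of the initial algebra. Given finite coproducts in $\mathcal C$, write $\varphi\colon T(\sum_i A_i)\to\bigotimes_i TA_i$ for the map underlying the canonical $\mathsf T$-algebra isomorphism $F^{\mathsf T}(\sum_i A_i)\cong\bigotimes_i F^{\mathsf T}A_i$ between two coproducts of the free algebras $F^{\mathsf T}A_i=(TA_i,\mu_{A_i})$. The $n$-ary hypernormalisation map is the composite in $\mathcal C$ $$\mathcal N\colon T(\textstyle\sum_i A_i)\xrightarrow{\varphi}\bigotimes_i TA_i\xrightarrow{\bigotimes_i\eta_{TA_i}}\bigotimes_i TTA_i\xrightarrow{\varphi^{-1}}T(\sum_i TA_i).$$ *)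

(* Defs.v *)
From mathcomp Require Import all_boot.
From Stdlib Require Import ProofIrrelevance.

Set Implicit Arguments.
Unset Strict Implicit.
Unset Printing Implicit Defensive.

Declare Scope cat_scope.
Delimit Scope cat_scope with cat.
Local Open Scope cat_scope.

Reserved Notation "g ∘ f" (at level 40, left associativity).
Reserved Notation "X ⊗ Y" (at level 35, right associativity).
Reserved Notation "f ⊗₁ g" (at level 35, right associativity).

(* Equality of morphisms is Leibniz equality. *)
Record category := Category {
  obj :> Type;
  hom : obj -> obj -> Type;
  idm : forall X, hom X X;
  comp : forall X Y Z, hom Y Z -> hom X Y -> hom X Z;
  comp1m : forall X Y (f : hom X Y), comp (idm Y) f = f;
  compm1 : forall X Y (f : hom X Y), comp f (idm X) = f;
  compmA : forall W X Y Z (h : hom Y Z) (g : hom X Y) (f : hom W X),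
    comp h (comp g f) = comp (comp h g) f }.

Arguments hom {c} _ _.
Arguments idm {c} X.
Arguments comp {c X Y Z} _ _.
Notation "g ∘ f" := (comp g f) : cat_scope.

Record iso (C : category) (X Y : C) := Iso {
  iso_hom : hom X Y;
  iso_inv : hom Y X;
  iso_homK : iso_inv ∘ iso_hom = idm X;
  iso_invK : iso_hom ∘ iso_inv = idm Y }.

Arguments iso {C} X Y.

Record functor (C D : category) := Functor {
  fobj :> C -> D;
  fmap : forall X Y : C, hom X Y -> hom (fobj X) (fobj Y);
  fmap1 : forall X : C, fmap (idm X) = idm (fobj X);
  fmapM : forall (X Y Z : C) (g : hom Y Z) (f : hom X Y),
    fmap (g ∘ f) = fmap g ∘ fmap f }.

Arguments fmap {C D} F {X Y} f : rename.

Record monad (C : category) := Monad {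
  endo :> functor C C;
  eta : forall X : C, hom X (endo X);
  mu : forall X : C, hom (endo (endo X)) (endo X);
  eta_nat : forall (X Y : C) (f : hom X Y), fmap endo f ∘ eta X = eta Y ∘ f;
  mu_nat : forall (X Y : C) (f : hom X Y),
    fmap endo f ∘ mu X = mu Y ∘ fmap endo (fmap endo f);
  mu_eta : forall X : C, mu X ∘ eta (endo X) = idm (endo X);
  mu_fmap_eta : forall X : C, mu X ∘ fmap endo (eta X) = idm (endo X);
  mu_mu : forall X : C, mu X ∘ mu (endo X) = mu X ∘ fmap endo (mu X) }.

Arguments eta {C} T X : rename.
Arguments mu {C} T X : rename.

(* Universal properties are given as structure: the mediating map together
   with its uniqueness. *)
Record is_initial (C : category) (Z : C) := IsInitial {
  init_map : forall X : C, hom Z X;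
  init_uniq : forall (X : C) (f : hom Z X), f = init_map X }.

Record is_coproduct2 (C : category) (X Y S : C) (i1 : hom X S) (i2 : hom Y S) :=
  IsCoproduct2 {
  copair : forall Z : C, hom X Z -> hom Y Z -> hom S Z;
  copair1 : forall (Z : C) (f : hom X Z) (g : hom Y Z), copair f g ∘ i1 = f;
  copair2 : forall (Z : C) (f : hom X Z) (g : hom Y Z), copair f g ∘ i2 = g;
  copair_uniq : forall (Z : C) (f : hom X Z) (g : hom Y Z) (h : hom S Z),
    h ∘ i1 = f -> h ∘ i2 = g -> h = copair f g }.

Record is_coproduct (C : category) (n : nat) (A : 'I_n -> C) (S : C)
    (inj : forall i, hom (A i) S) := IsCoproduct {
  cotuple : forall Z : C, (forall i, hom (A i) Z) -> hom S Z;
  cotuple_inj : forall (Z : C) (f : forall i, hom (A i) Z) i,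
    cotuple f ∘ inj i = f i;
  cotuple_uniq : forall (Z : C) (f : forall i, hom (A i) Z) (h : hom S Z),
    (forall i, h ∘ inj i = f i) -> h = cotuple f }.

Lemma cotuple_ext (C : category) (n : nat) (A : 'I_n -> C) (S : C)
    (inj : forall i, hom (A i) S) (P : is_coproduct inj) (Z : C) (h k : hom S Z) :
  (forall i, h ∘ inj i = k ∘ inj i) -> h = k.
Proof.
move=> e; rewrite (cotuple_uniq P (f := fun i => k ∘ inj i) (h := h)) //.
by symmetry; apply: cotuple_uniq.
Qed.

Definition coproduct_iso (C : category) (n : nat) (A : 'I_n -> C) (S S' : C)
  (inj : forall i, hom (A i) S) (inj' : forall i, hom (A i) S')
  (P : is_coproduct inj) (P' : is_coproduct inj') : iso S S'.
Proof.
refine (@Iso C S S' (cotuple P inj') (cotuple P' inj) _ _).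
- by apply: (cotuple_ext P) => i; rewrite -compmA !cotuple_inj comp1m.
- by apply: (cotuple_ext P') => i; rewrite -compmA !cotuple_inj comp1m.
Defined.

(* A choice of coproduct for every finite family of objects. *)
Record finite_coproducts (C : category) := FiniteCoproducts {
  csum : forall n, ('I_n -> C) -> C;
  cinj : forall n (A : 'I_n -> C) i, hom (A i) (csum A);
  csumP : forall n (A : 'I_n -> C), is_coproduct (cinj A) }.

Arguments csum {C} S {n} A : rename.
Arguments cinj {C} S {n} A i : rename.
Arguments csumP {C} S {n} A : rename.

(* With the symmetry axiom, one hexagon gives the other. *)
Record smcat := SMCat {
  smcat_cat :> category;
  munit : smcat_cat;
  tensor : smcat_cat -> smcat_cat -> smcat_cat
    where "X ⊗ Y" := (tensor X Y);
  tensorm : forall X Y X' Y' : smcat_cat,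
    hom X X' -> hom Y Y' -> hom (X ⊗ Y) (X' ⊗ Y')
    where "f ⊗₁ g" := (tensorm f g);
  assoc : forall X Y Z : smcat_cat, iso ((X ⊗ Y) ⊗ Z) (X ⊗ (Y ⊗ Z));
  lunit : forall X : smcat_cat, iso (munit ⊗ X) X;
  runit : forall X : smcat_cat, iso (X ⊗ munit) X;
  braid : forall X Y : smcat_cat, hom (X ⊗ Y) (Y ⊗ X);
  tensorm1 : forall X Y : smcat_cat, idm X ⊗₁ idm Y = idm (X ⊗ Y);
  tensormM : forall (X Y X' Y' X'' Y'' : smcat_cat)
      (f' : hom X' X'') (f : hom X X') (g' : hom Y' Y'') (g : hom Y Y'),
    (f' ∘ f) ⊗₁ (g' ∘ g) = (f' ⊗₁ g') ∘ (f ⊗₁ g);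
  assoc_nat : forall (X Y Z X' Y' Z' : smcat_cat)
      (f : hom X X') (g : hom Y Y') (h : hom Z Z'),
    iso_hom (assoc X' Y' Z') ∘ ((f ⊗₁ g) ⊗₁ h) =
    (f ⊗₁ (g ⊗₁ h)) ∘ iso_hom (assoc X Y Z);
  lunit_nat : forall (X Y : smcat_cat) (f : hom X Y),
    iso_hom (lunit Y) ∘ (idm munit ⊗₁ f) = f ∘ iso_hom (lunit X);
  runit_nat : forall (X Y : smcat_cat) (f : hom X Y),
    iso_hom (runit Y) ∘ (f ⊗₁ idm munit) = f ∘ iso_hom (runit X);
  braid_nat : forall (X Y X' Y' : smcat_cat) (f : hom X X') (g : hom Y Y'),
    braid X' Y' ∘ (f ⊗₁ g) = (g ⊗₁ f) ∘ braid X Y;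
  pentagon : forall W X Y Z : smcat_cat,
    iso_hom (assoc W X (Y ⊗ Z)) ∘ iso_hom (assoc (W ⊗ X) Y Z) =
    (idm W ⊗₁ iso_hom (assoc X Y Z)) ∘ iso_hom (assoc W (X ⊗ Y) Z)
      ∘ (iso_hom (assoc W X Y) ⊗₁ idm Z);
  triangle : forall X Y : smcat_cat,
    (idm X ⊗₁ iso_hom (lunit Y)) ∘ iso_hom (assoc X munit Y) =
    iso_hom (runit X) ⊗₁ idm Y;
  hexagon : forall X Y Z : smcat_cat,
    iso_hom (assoc Y Z X) ∘ braid X (Y ⊗ Z) ∘ iso_hom (assoc X Y Z) =
    (idm Y ⊗₁ braid X Z) ∘ iso_hom (assoc Y X Z) ∘ (braid X Y ⊗₁ idm Z);
  braidK : forall X Y : smcat_cat, braid Y X ∘ braid X Y = idm (X ⊗ Y) }.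

Arguments munit {s}.
Arguments tensor {s} X Y.
Arguments tensorm {s X Y X' Y'} f g.
Arguments assoc {s} X Y Z.
Arguments lunit {s} X.
Arguments runit {s} X.
Arguments braid {s} X Y.
Notation "X ⊗ Y" := (tensor X Y) : cat_scope.
Notation "f ⊗₁ g" := (tensorm f g) : cat_scope.

(* The n-ary tensor product is bracketed to the right and ends in the unit:
   A_0 ⊗ (A_1 ⊗ (... ⊗ (A_{n-1} ⊗ I))).
   Any other bracketing differs from it by a coherence isomorphism. *)
Fixpoint bigtensor (C : smcat) (n : nat) : ('I_n -> C) -> C :=
  match n with
  | 0 => fun _ => munit
  | m.+1 => fun A => A ord0 ⊗ bigtensor (fun j : 'I_m => A (lift ord0 j))
  end.

Fixpoint bigtensorm (C : smcat) (n : nat) : forall A B : 'I_n -> C,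
    (forall i, hom (A i) (B i)) -> hom (bigtensor A) (bigtensor B) :=
  match n with
  | 0 => fun _ _ _ => idm munit
  | m.+1 => fun A B f =>
      f ord0 ⊗₁ bigtensorm (fun j : 'I_m => f (lift ord0 j))
  end.

Definition tinj1 (C : smcat) (iI : is_initial (@munit C)) (X Y : C) :
    hom X (X ⊗ Y) :=
  (idm X ⊗₁ init_map iI Y) ∘ iso_inv (runit X).

Definition tinj2 (C : smcat) (iI : is_initial (@munit C)) (X Y : C) :
    hom Y (X ⊗ Y) :=
  (init_map iI X ⊗₁ idm Y) ∘ iso_inv (lunit Y).

Record cocartesian (C : smcat) := Cocartesian {
  cocart_init : is_initial (@munit C);
  cocart_coprod : forall X Y : C,
    is_coproduct2 (tinj1 cocart_init X Y) (tinj2 cocart_init X Y) }.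

Record opmonoidal_monad (C : smcat) := OpmonoidalMonad {
  opm_monad :> monad C;
  ups0 : hom (opm_monad munit) munit;
  ups : forall X Y : C, hom (opm_monad (X ⊗ Y)) (opm_monad X ⊗ opm_monad Y);
  ups_nat : forall (X Y X' Y' : C) (f : hom X X') (g : hom Y Y'),
    ups X' Y' ∘ fmap opm_monad (f ⊗₁ g) =
    (fmap opm_monad f ⊗₁ fmap opm_monad g) ∘ ups X Y;
  ups_assoc : forall X Y Z : C,
    iso_hom (assoc _ _ _) ∘ (ups X Y ⊗₁ idm (opm_monad Z)) ∘ ups (X ⊗ Y) Z =
    (idm (opm_monad X) ⊗₁ ups Y Z) ∘ ups X (Y ⊗ Z)
      ∘ fmap opm_monad (iso_hom (assoc X Y Z));
  ups_lunit : forall X : C,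
    iso_hom (lunit _) ∘ (ups0 ⊗₁ idm (opm_monad X)) ∘ ups munit X =
    fmap opm_monad (iso_hom (lunit X));
  ups_runit : forall X : C,
    iso_hom (runit _) ∘ (idm (opm_monad X) ⊗₁ ups0) ∘ ups X munit =
    fmap opm_monad (iso_hom (runit X));
  ups_braid : forall X Y : C,
    braid _ _ ∘ ups X Y = ups Y X ∘ fmap opm_monad (braid X Y);
  ups0_eta : ups0 ∘ eta opm_monad munit = idm munit;
  ups_eta : forall X Y : C,
    ups X Y ∘ eta opm_monad (X ⊗ Y) = eta opm_monad X ⊗₁ eta opm_monad Y;
  ups0_mu : ups0 ∘ mu opm_monad munit = ups0 ∘ fmap opm_monad ups0;
  ups_mu : forall X Y : C,
    ups X Y ∘ mu opm_monad (X ⊗ Y) =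
    (mu opm_monad X ⊗₁ mu opm_monad Y)
      ∘ (ups (opm_monad X) (opm_monad Y) ∘ fmap opm_monad (ups X Y)) }.

Arguments ups0 {C} T : rename.
Arguments ups {C} T X Y : rename.

(* The structure is separated from its carrier so that the carrier of an n-ary
   tensor product of algebras is by definition the n-ary tensor product of the
   carriers (see [bigalg]). *)
Record alg_on (C : category) (T : monad C) (X : C) := AlgOn {
  act : hom (T X) X;
  act_eta : act ∘ eta T X = idm X;
  act_mu : act ∘ mu T X = act ∘ fmap T act }.

Record algebra (C : category) (T : monad C) := Algebra {
  carrier : C;
  alg_str : alg_on T carrier }.

Definition alg_act (C : category) (T : monad C) (X : algebra T) :
  hom (T (carrier X)) (carrier X) := act (alg_str X).

Record alg_hom (C : category) (T : monad C) (X Y : algebra T) := AlgHom {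
  alg_map : hom (carrier X) (carrier Y);
  alg_mapP : alg_map ∘ alg_act X = alg_act Y ∘ fmap T alg_map }.

Section EilenbergMoore.
Context (C : category) (T : monad C).

Lemma alg_hom_eq (X Y : algebra T) (f g : alg_hom X Y) :
  alg_map f = alg_map g -> f = g.
Proof.
case: f g => [f fP] [g gP] /= e; case: _ / e gP => gP.
by rewrite (proof_irrelevance _ fP gP).
Qed.

Definition alg_id (X : algebra T) : alg_hom X X.
Proof. by exists (idm (carrier X)); rewrite fmap1 comp1m compm1. Defined.

Definition alg_comp (X Y Z : algebra T) (g : alg_hom Y Z) (f : alg_hom X Y) :
  alg_hom X Z.
Proof.
exists (alg_map g ∘ alg_map f).
by rewrite fmapM compmA -alg_mapP -!compmA -alg_mapP.
Defined.

Definition EM : category.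
Proof.
refine (@Category (algebra T) (@alg_hom C T) alg_id alg_comp _ _ _).
- by move=> X Y f; apply: alg_hom_eq; rewrite /= comp1m.
- by move=> X Y f; apply: alg_hom_eq; rewrite /= compm1.
- by move=> W X Y Z h g f; apply: alg_hom_eq; rewrite /= compmA.
Defined.

Lemma alg_iso_inv (X Y : EM) (e : iso (carrier X) (carrier Y)) :
  iso_hom e ∘ alg_act X = alg_act Y ∘ fmap T (iso_hom e) ->
  iso_inv e ∘ alg_act Y = alg_act X ∘ fmap T (iso_inv e).
Proof.
move=> eP; rewrite -[LHS]compm1 -(fmap1 T) -(iso_invK e) fmapM compmA.
by rewrite -(compmA (iso_inv e)) -eP !compmA iso_homK comp1m.
Qed.

Definition alg_iso (X Y : EM) (e : iso (carrier X) (carrier Y))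
  (eP : iso_hom e ∘ alg_act X = alg_act Y ∘ fmap T (iso_hom e)) : iso X Y :=
  let f := AlgHom eP in
  let g := AlgHom (alg_iso_inv eP) in
  @Iso EM X Y f g
    (@alg_hom_eq X X (alg_comp g f) (alg_id X) (iso_homK e))
    (@alg_hom_eq Y Y (alg_comp f g) (alg_id Y) (iso_invK e)).

Definition free_alg (A : C) : EM :=
  Algebra (AlgOn (mu_eta T A) (mu_mu T A)).

Definition free_map (A B : C) (f : hom A B) : hom (free_alg A) (free_alg B) :=
  @AlgHom C T (free_alg A) (free_alg B) (fmap T f) (mu_nat T f).

Definition free_ext (A : C) (X : EM) (f : hom A (carrier X)) :
  hom (free_alg A) X.
Proof.
exists (alg_act X ∘ fmap T f).
rewrite /alg_act /= -compmA mu_nat compmA act_mu fmapM.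
by rewrite !compmA.
Defined.

Lemma free_ext_eta (A : C) (X : EM) (f : hom A (carrier X)) :
  alg_map (free_ext f) ∘ eta T A = f.
Proof. by rewrite /= -compmA eta_nat compmA /alg_act act_eta comp1m. Qed.

Lemma free_ext_uniq (A : C) (X : EM) (f g : hom (free_alg A) X) :
  alg_map f ∘ eta T A = alg_map g ∘ eta T A -> f = g.
Proof.
have E (h : hom (free_alg A) X) :
    alg_map h = alg_act X ∘ fmap T (alg_map h ∘ eta T A).
  by rewrite fmapM compmA -alg_mapP /alg_act /= -compmA mu_fmap_eta compm1.
by move=> e; apply: alg_hom_eq; rewrite (E f) (E g) e.
Qed.

(* The free functor, being a left adjoint, preserves coproducts. *)
Definition free_coproduct (n : nat) (A : 'I_n -> C) (S : C)
  (inj : forall i, hom (A i) S) (P : is_coproduct inj) :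
  is_coproduct (C := EM) (fun i => free_map (inj i)).
Proof.
exists (fun (X : EM) (f : forall i, hom (free_alg (A i)) X) =>
          free_ext (cotuple P (fun i => alg_map (f i) ∘ eta T (A i)))).
- move=> X f i; apply: free_ext_uniq.
  set g := free_ext _.
  change (alg_map g ∘ fmap T (inj i) ∘ eta T (A i) = alg_map (f i) ∘ eta T (A i)).
  by rewrite -compmA eta_nat compmA free_ext_eta cotuple_inj.
- move=> X f h e; apply: free_ext_uniq; rewrite free_ext_eta.
  apply: cotuple_uniq => i; rewrite -compmA -eta_nat compmA.
  by rewrite -(e i).
Defined.

End EilenbergMoore.

Section Lifting.
Context (C : smcat) (T : opmonoidal_monad C).

Definition unit_alg : EM T := Algebra (AlgOn (ups0_eta T) (ups0_mu T)).

Definition tensor_alg_on (X Y : C) (x : alg_on T X) (y : alg_on T Y) :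
  alg_on T (X ⊗ Y).
Proof.
exists ((act x ⊗₁ act y) ∘ ups T X Y).
- by rewrite -compmA ups_eta -tensormM !act_eta tensorm1.
- rewrite -compmA ups_mu compmA -tensormM !act_mu tensormM fmapM.
  by rewrite !compmA -(compmA _ (ups T X Y)) ups_nat !compmA.
Defined.

Definition tensor_alg (X Y : EM T) : EM T :=
  Algebra (tensor_alg_on (alg_str X) (alg_str Y)).

Definition tensor_algm (X Y X' Y' : EM T) (f : hom X X') (g : hom Y Y') :
  hom (tensor_alg X Y) (tensor_alg X' Y').
Proof.
exists (alg_map f ⊗₁ alg_map g).
rewrite /alg_act /= compmA -tensormM [alg_map f ∘ _](alg_mapP f).
rewrite [alg_map g ∘ _](alg_mapP g) tensormM.
by rewrite -!compmA ups_nat.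
Defined.

Definition assoc_alg (X Y Z : EM T) :
  iso (tensor_alg (tensor_alg X Y) Z) (tensor_alg X (tensor_alg Y Z)).
Proof.
apply: (@alg_iso C T (tensor_alg (tensor_alg X Y) Z)
  (tensor_alg X (tensor_alg Y Z)) (assoc (carrier X) (carrier Y) (carrier Z))).
rewrite /alg_act /=.
rewrite -{1}[act (alg_str Z)]compm1 tensormM !compmA assoc_nat.
rewrite -{2}[act (alg_str X)]compm1 tensormM -!compmA.
by congr (_ ∘ _); rewrite !compmA ups_assoc.
Defined.

Definition lunit_alg (X : EM T) : iso (tensor_alg unit_alg X) X.
Proof.
apply: (@alg_iso C T (tensor_alg unit_alg X) X (lunit (carrier X))).
rewrite /alg_act /= -ups_lunit.
rewrite -{1}(comp1m (ups0 T)) -{1}(compm1 (act (alg_str X))) tensormM.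
by rewrite !compmA lunit_nat.
Defined.

Definition runit_alg (X : EM T) : iso (tensor_alg X unit_alg) X.
Proof.
apply: (@alg_iso C T (tensor_alg X unit_alg) X (runit (carrier X))).
rewrite /alg_act /= -ups_runit.
rewrite -{1}(comp1m (ups0 T)) -{1}(compm1 (act (alg_str X))) tensormM.
by rewrite !compmA runit_nat.
Defined.

Definition braid_alg (X Y : EM T) : hom (tensor_alg X Y) (tensor_alg Y X).
Proof.
exists (braid (carrier X) (carrier Y)).
by rewrite /alg_act /= compmA braid_nat -!compmA ups_braid.
Defined.

Definition EMt : smcat.
Proof.
refine (@SMCat (EM T) unit_alg tensor_alg tensor_algm
          assoc_alg lunit_alg runit_alg braid_alg _ _ _ _ _ _ _ _ _ _);
  move=> *; apply: alg_hom_eq => /=.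
- exact: tensorm1.
- exact: tensormM.
- exact: assoc_nat.
- exact: lunit_nat.
- exact: runit_nat.
- exact: braid_nat.
- exact: pentagon.
- exact: triangle.
- exact: hexagon.
- exact: braidK.
Defined.

(* [bigalg X] is [bigtensor] in [EMt], presented with carrier
   [bigtensor (carrier \o X)]. *)
Fixpoint bigalg_on (n : nat) : forall X : 'I_n -> EM T,
    alg_on T (bigtensor (fun i => carrier (X i))) :=
  match n with
  | 0 => fun _ => alg_str unit_alg
  | m.+1 => fun X => tensor_alg_on (alg_str (X ord0))
                       (bigalg_on (fun j : 'I_m => X (lift ord0 j)))
  end.

Definition bigalg (n : nat) (X : 'I_n -> EM T) : EM T := Algebra (bigalg_on X).

Lemma bigalg_bigtensor (n : nat) (X : 'I_n -> EM T) :
  bigalg X = bigtensor (C := EMt) X.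
Proof. by elim: n X => [|n IHn] X //=; rewrite -IHn. Qed.

End Lifting.

Record linear_exponential_monad (C : smcat) := LinearExponentialMonad {
  lem_opm :> opmonoidal_monad C;
  lem_cocart : cocartesian (EMt lem_opm) }.

Definition ord_case (n : nat) (P : 'I_n.+1 -> Type) (P0 : P ord0)
    (PS : forall j, P (lift ord0 j)) (i : 'I_n.+1) : P i :=
  match unliftP ord0 i with
  | UnliftSome j e => eq_rect_r P (PS j) e
  | UnliftNone e => eq_rect_r P P0 e
  end.

Lemma ord_case0 (n : nat) (P : 'I_n.+1 -> Type) (P0 : P ord0)
  (PS : forall j, P (lift ord0 j)) : ord_case P0 PS ord0 = P0.
Proof.
rewrite /ord_case; case: unliftP => [j e|e].
  by exfalso; move: (neq_lift ord0 j); rewrite -e eqxx.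
by rewrite (eq_irrelevance e erefl).
Qed.

Lemma ord_caseS (n : nat) (P : 'I_n.+1 -> Type) (P0 : P ord0)
  (PS : forall j, P (lift ord0 j)) (j : 'I_n) : ord_case P0 PS (lift ord0 j) = PS j.
Proof.
rewrite /ord_case; case: unliftP => [k e|e]; last first.
  by exfalso; move: (neq_lift ord0 j); rewrite e eqxx.
have jk : j = k by exact: lift_inj e.
by case: _ / jk e => e; rewrite (eq_irrelevance e erefl).
Qed.

Section CoproductAlgebras.
Context (C : smcat) (T : linear_exponential_monad C).

Fixpoint biginj (n : nat) : forall (X : 'I_n -> EMt T) (i : 'I_n),
    hom (X i) (bigalg X : EMt T) :=
  match n with
  | 0 => fun X i => False_rect _ (notF (ltn_ord i))
  | m.+1 => fun X =>
      let Y : EMt T := bigalg (fun j : 'I_m => X (lift ord0 j)) in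
      ord_case (P := fun i => hom (X i) (X ord0 ⊗ Y))
        (tinj1 (cocart_init (lem_cocart T)) (X ord0) Y)
        (fun j => tinj2 (cocart_init (lem_cocart T)) (X ord0) Y
                    ∘ biginj (fun j : 'I_m => X (lift ord0 j)) j)
  end.

Lemma biginj0 (n : nat) (X : 'I_n.+1 -> EMt T) :
  biginj X ord0 = tinj1 (cocart_init (lem_cocart T)) (X ord0)
                    (bigalg (fun j : 'I_n => X (lift ord0 j))).
Proof. exact: ord_case0. Qed.

Lemma biginjS (n : nat) (X : 'I_n.+1 -> EMt T) (j : 'I_n) :
  biginj X (lift ord0 j) =
  tinj2 (cocart_init (lem_cocart T)) (X ord0)
    (bigalg (fun j : 'I_n => X (lift ord0 j)) : EMt T)
    ∘ biginj (fun j : 'I_n => X (lift ord0 j)) j.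
Proof.
exact: (ord_caseS (P := fun i => hom (X i) (bigalg X : EMt T))).
Qed.

Definition bigalg_coproduct (n : nat) (X : 'I_n -> EMt T) :
  is_coproduct (biginj X).
Proof.
elim: n X => [|n IHn] X.
  exists (fun Z _ => init_map (cocart_init (lem_cocart T)) Z) => [Z f []//|Z f h _].
  exact: init_uniq.
pose P := cocart_coprod (lem_cocart T) (X ord0)
            (bigalg (fun j : 'I_n => X (lift ord0 j))).
pose Q := IHn (fun j : 'I_n => X (lift ord0 j)).
exists (fun (Z : EMt T) (f : forall i, hom (X i) Z) =>
          copair P (f ord0) (cotuple Q (fun j => f (lift ord0 j)))).
- move=> Z f i; elim/ord_case: i => [|j].
    by rewrite biginj0; apply: (copair1 P).
  rewrite biginjS; etransitivity; first exact: compmA.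
  by rewrite (copair2 P); apply: (cotuple_inj Q).
- move=> Z f h e; apply: copair_uniq.
    by rewrite -(e ord0) biginj0.
  apply: cotuple_uniq => j.
  rewrite -(e (lift ord0 j)) biginjS.
  by symmetry; apply: compmA.
Defined.

Context (S : finite_coproducts C).

(* The canonical isomorphism in [EMt T] between two coproducts of the free
   algebras on the A_i: the image under the free functor of the coproduct of
   the A_i, and the tensor product of these free algebras. *)
Definition phi_iso (n : nat) (A : 'I_n -> C) :
    iso (C := EMt T) (free_alg T (csum S A)) (bigalg (fun i => free_alg T (A i))) :=
  coproduct_iso (free_coproduct T (csumP S A))
    (bigalg_coproduct (fun i => free_alg T (A i))).

Definition phi (n : nat) (A : 'I_n -> C) :
    hom (T (csum S A)) (bigtensor (fun i => T (A i))) :=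
  alg_map (iso_hom (phi_iso A)).

Definition phi_inv (n : nat) (A : 'I_n -> C) :
    hom (bigtensor (fun i => T (A i))) (T (csum S A)) :=
  alg_map (iso_inv (phi_iso A)).

Definition hypernorm (n : nat) (A : 'I_n -> C) :
    hom (T (csum S A)) (T (csum S (fun i => T (A i)))) :=
  phi_inv (fun i => T (A i))
    ∘ bigtensorm (fun i => eta T (T (A i)))
    ∘ phi A.

End CoproductAlgebras.

Arguments hypernorm {C} T S {n} A.

(* Main.v *)
Require Import Defs.
From mathcomp Require Import all_boot.
Local Open Scope cat_scope.

(** When the unit is initial in [C], the coprojections into a tensor product of
    algebras, being built from maps out of the unit, are natural for arbitrary
    maps of [C] between the carriers and not only for algebra homomorphisms.
    Applied to the maps [eta], which are not homomorphisms, this naturality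
    carries the coprojections past the middle factor of the hypernormalisation
    map; the two isomorphisms [phi] only exchange coprojections. *)

(** Serves to pass naturality from the unitors to their inverses, which occur in the
    coprojections. *)
Lemma iso_inv_conj {C : category} {X X' Y Y' : C} {e : iso X X'} {e' : iso Y Y'}
    {f : hom X Y} {g : hom X' Y'} :
  iso_hom e' ∘ f = g ∘ iso_hom e -> f ∘ iso_inv e = iso_inv e' ∘ g.
Proof.
move=> fg; rewrite -[LHS]comp1m -(iso_homK e') -compmA (compmA _ f) fg.
by rewrite -(compmA g) iso_invK compm1.
Qed.

Section CoaffineNaturality.
Context {C : smcat} (coaffine : is_initial (@munit C)).

Lemma alg_map_comp (T : opmonoidal_monad C) {X Y Z : EMt T}
    (g : hom Y Z) (f : hom X Y) :
  alg_map (g ∘ f) = alg_map g ∘ alg_map f.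
Proof. by []. Qed.

(** The unique algebra map out of the unit has underlying map out of [munit], which co-affineness
    determines; the algebra structures drop out. *)
Lemma alg_map_tinj1 (T : opmonoidal_monad C) (iI : is_initial (@munit (EMt T)))
    (X Y : EMt T) :
  alg_map (tinj1 iI X Y) = tinj1 coaffine (carrier X) (carrier Y).
Proof.
by rewrite /tinj1 -(init_uniq coaffine (alg_map (init_map iI Y))).
Qed.

Lemma alg_map_tinj2 (T : opmonoidal_monad C) (iI : is_initial (@munit (EMt T)))
    (X Y : EMt T) :
  alg_map (tinj2 iI X Y) = tinj2 coaffine (carrier X) (carrier Y).
Proof.
by rewrite /tinj2 -(init_uniq coaffine (alg_map (init_map iI X))).
Qed.

(** Composing [g] with the unique map from the unit gives again the unique map. *)
Lemma tinj1_nat {X Y X' Y' : C} (f : hom X X') (g : hom Y Y') :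
  (f ⊗₁ g) ∘ tinj1 coaffine X Y = tinj1 coaffine X' Y' ∘ f.
Proof.
rewrite /tinj1 -compmA -(iso_inv_conj (runit_nat f)) !compmA -!tensormM.
by rewrite comp1m !compm1 (init_uniq coaffine (g ∘ _)).
Qed.

Lemma tinj2_nat {X Y X' Y' : C} (f : hom X X') (g : hom Y Y') :
  (f ⊗₁ g) ∘ tinj2 coaffine X Y = tinj2 coaffine X' Y' ∘ g.
Proof.
rewrite /tinj2 -compmA -(iso_inv_conj (lunit_nat g)) !compmA -!tensormM.
by rewrite comp1m !compm1 (init_uniq coaffine (f ∘ _)).
Qed.

Lemma biginj_nat (T : linear_exponential_monad C) {n : nat} (X Y : 'I_n -> EMt T)
    (f : forall i, hom (carrier (X i)) (carrier (Y i))) (i : 'I_n) :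
  bigtensorm f ∘ alg_map (biginj X i) = alg_map (biginj Y i) ∘ f i.
Proof.
elim: n X Y f i => [|n IHn] X Y f i; first by case: i.
elim/ord_case: i => [|j].
  by rewrite !biginj0 !alg_map_tinj1; apply: tinj1_nat.
(* Writing the carrier of [bigalg] as a [bigtensor] lets [tinj2_nat] apply to the unfolded
   [bigtensorm]. *)
have injS (Z : 'I_n.+1 -> EMt T) : alg_map (biginj Z (lift ord0 j)) =
    tinj2 coaffine (carrier (Z ord0)) (bigtensor (fun k => carrier (Z (lift ord0 k))))
      ∘ alg_map (biginj (fun k => Z (lift ord0 k)) j).
  by rewrite biginjS alg_map_comp; congr (_ ∘ _); apply: alg_map_tinj2.
rewrite !injS compmA tinj2_nat -!compmA.
by rewrite (IHn (fun k => X (lift ord0 k)) (fun k => Y (lift ord0 k))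
  (fun k => f (lift ord0 k))).
Qed.

End CoaffineNaturality.

Section PhiCoprojections.
Context {C : smcat} (T : linear_exponential_monad C) (S : finite_coproducts C).
Context {n : nat} (A : 'I_n -> C) (i : 'I_n).

(** The defining property of the mediating map between the two coproducts of free algebras, read in
    [C]. *)
Lemma phi_inj :
  phi T S A ∘ fmap T (cinj S A i) =
  alg_map (biginj (fun j => free_alg T (A j) : EMt T) i).
Proof.
have e := cotuple_inj (free_coproduct T (csumP S A))
            (biginj (fun j => free_alg T (A j) : EMt T)) i.
exact: (congr1 (@alg_map _ _ _ _) e).
Qed.

Lemma phi_inv_biginj :
  phi_inv T S A ∘ alg_map (biginj (fun j => free_alg T (A j) : EMt T) i) =
  fmap T (cinj S A i).
Proof.
have e := cotuple_inj (bigalg_coproduct (fun j => free_alg T (A j) : EMt T))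
            (fun j => free_map T (cinj S A j)) i.
exact: (congr1 (@alg_map _ _ _ _) e).
Qed.

End PhiCoprojections.

Theorem proposition20 (C : smcat) (S : finite_coproducts C)
    (coaffine : is_initial (@munit C)) (T : linear_exponential_monad C)
    (n : nat) (A : 'I_n -> C) (i : 'I_n) :
  hypernorm T S A ∘ fmap T (cinj S A i) =
  eta T (csum S (fun j => T (A j))) ∘ cinj S (fun j => T (A j)) i.
Proof.
have eta_inj : bigtensorm (fun j => eta T (T (A j)))
      ∘ alg_map (biginj (fun j => free_alg T (A j) : EMt T) i) =
    alg_map (biginj (fun j => free_alg T (T (A j)) : EMt T) i) ∘ eta T (T (A i)).
  exact: (biginj_nat coaffine T (fun j => free_alg T (A j))
            (fun j => free_alg T (T (A j))) (fun j => eta T (T (A j)))).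
(* What remains after the three factors is naturality of [eta] at the coprojection. *)
by rewrite /hypernorm -2!compmA phi_inj eta_inj compmA phi_inv_biginj eta_nat.
Qed.
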